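(* Let $\mathcal{H}$ be a reproducing kernel Hilbert space on a non-empty set $\Omega$, let $T\in B(\mathcal{H})$, let $\mu\in[0,1]$, and let $\sigma_\mu$ be an interpolation path of a symmetric mean $\sigma$. Then, for $p\ge1$, $$\|T\|_{\sigma_\mu\text{-ber}}^p\le\sup_{\lambda\in\Omega}\left\{\left[\frac14\left\langle(T^*T+TT^* )\hat k_\lambda,\hat k_\lambda\right\rangle+\frac12\left|\langle T^2\hat k_\lambda,\hat k_\lambda\rangle\right|\right]^{\frac p2}\ \sigma_\mu\ \left(\langle|T|^2\hat k_\lambda,\hat k_\lambda\rangle\right)^{\frac p2}\right\}.$$
   Context: A reproducing kernel Hilbert space on $\Omega$ is a Hilbert space of complex-valued functions on $\Omega$ whose point evaluations are bounded; $k_\lambda$ is the reproducing kernel at $\lambda\in\Omega$ (assumed nonzero) and $\hat k_\lambda=k_\lambda/\|k_\lambda\|$. $B(\mathcal{H})$ is the algebra of bounded linear operators on $\mathcal{H}$, and $|T|=(T^*T)^{1/2}$. A mean is a continuous function $\sigma:[0,\infty)^2\to[0,\infty)$, written $a\sigma b$, monotone increasing in each variable, with $a\le a\sigma b\le b$ whenever $a\le b$, and $(\alpha a)\sigma(\alpha b)=\alpha(a\sigma b)$ for $\alpha>0$. It is symmetric if $a\sigma b=b\sigma a$. An interpolation path for a symmetric mean $\sigma$ is a family of means $\sigma_\mu$, $\mu\in[0,1]$, each increasing in each component, with $a\sigma_0b=b$, $a\sigma_1b=a$, $a\sigma_{1/2}b=a\sigma b$, and $(a\sigma_\mu b)\sigma(a\sigma_\nu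 b)=a\sigma_{\frac{\mu+\nu}2}b$ for all $\mu,\nu\in[0,1]$, $a,b\ge0$. For $p\ge1$ and $\mu\in[0,1]$, the $\sigma_\mu$-Berezin norm (depending also on $p$) is $\|T\|_{\sigma_\mu\text{-ber}}=\sup_{\lambda\in\Omega}\left(|\langle T\hat k_\lambda,\hat k_\lambda\rangle|^p\,\sigma_\mu\,\|T\hat k_\lambda\|^p\right)^{1/p}$. *)

(* Defs.v *)
From HB Require Import structures.
From mathcomp Require Import all_boot all_order all_algebra.
From mathcomp Require Import sesquilinear.
From mathcomp Require Import all_classical all_reals all_analysis.
From mathcomp Require Import complex.
Set Implicit Arguments.
Unset Strict Implicit.
Unset Printing Implicit Defensive.
Import Order.TTheory GRing.Theory Num.Theory.
Import numFieldNormedType.Exports.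
Local Open Scope classical_set_scope.
Local Open Scope ring_scope.

(* Library norms over R[i] take their values in R[i]; [rnorm] is the same
   nonnegative number, seen in R.  It applies both to vectors and, with
   V := R[i], to complex scalars (modulus). *)
Definition rnorm (R : realType) (V : normedZmodType R[i]) (v : V) : R :=
  complex.Re `|v|.

(* Elements are functions on [Omega] through the injective evaluation map;
   [inner] is linear in its first argument. *)
Record rkhs (R : realType) (Omega : Type) : Type := Rkhs {
  rkhs_sort :> completeNormedModType R[i];
  inner : {dot rkhs_sort for (@Num.conj R[i])};
  rkhs_normE : forall f : rkhs_sort, `|f| ^+ 2 = inner f f;
  ev : Omega -> {scalar rkhs_sort};
  ev_inj : forall f g : rkhs_sort, (forall x, ev x f = ev x g) -> f = g;
  ev_bounded : forall x, exists M : R,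
    forall f : rkhs_sort, rnorm (ev x f) <= M * rnorm f
}.

Definition bounded_op (R : realType) (V : normedModType R[i]) (T : V -> V) :=
  exists M : R, forall v, rnorm (T v) <= M * rnorm v.

(* k_x, the vector (unique, by the Riesz theorem) such that
   f(x) = <f, k_x> for every f. *)
Definition rkernel (R : realType) (Omega : Type) (H : rkhs R Omega)
    (x : Omega) : H :=
  xget 0 [set k : H | forall f : H, ev H x f = inner H f k].

Definition nrkernel (R : realType) (Omega : Type) (H : rkhs R Omega)
    (x : Omega) : H :=
  `|rkernel H x|^-1 *: rkernel H x.

(* T^*: for bounded linear T, exactly one map satisfies the condition, and it
   is bounded and linear. *)
Definition adjoint (R : realType) (Omega : Type) (H : rkhs R Omega)
    (T : H -> H) : H -> H :=
  xget (fun=> 0)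
    [set S : H -> H | forall f g, inner H (T f) g = inner H f (S g)].

Definition positive_op (R : realType) (Omega : Type) (H : rkhs R Omega)
    (A : H -> H) :=
  [/\ linear A, bounded_op A & forall f, 0 <= inner H (A f) f].

(* |T| = (T^* T)^(1/2), the unique positive square root of T^* T. *)
Definition abs_op (R : realType) (Omega : Type) (H : rkhs R Omega)
    (T : H -> H) : H -> H :=
  xget (fun=> 0)
    [set A : H -> H | positive_op A /\ forall f, A (A f) = adjoint T (T f)].

(* Only the values on [0, +oo)^2 are constrained. *)
Record is_mean (R : realType) (s : R -> R -> R) : Prop := IsMean {
  mean_ge0 : forall a b, 0 <= a -> 0 <= b -> 0 <= s a b;
  mean_cont : {within [set ab : R * R | 0 <= ab.1 /\ 0 <= ab.2],
                 continuous (fun ab : R * R => s ab.1 ab.2)};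
  mean_homol : forall a a' b, 0 <= a -> a <= a' -> 0 <= b -> s a b <= s a' b;
  mean_homor : forall a b b', 0 <= a -> 0 <= b -> b <= b' -> s a b <= s a b';
  mean_between : forall a b, 0 <= a -> a <= b -> a <= s a b /\ s a b <= b;
  mean_scale : forall c a b, 0 < c -> 0 <= a -> 0 <= b ->
    s (c * a) (c * b) = c * s a b
}.

Definition is_symmetric_mean (R : realType) (s : R -> R -> R) : Prop :=
  is_mean s /\ forall a b, 0 <= a -> 0 <= b -> s a b = s b a.

(* [fam m] is the mean sigma_m; it is only constrained for m in [0, 1]. *)
Record is_interpolation_path (R : realType) (s : R -> R -> R)
    (fam : R -> R -> R -> R) : Prop := IsInterpolationPath {
  path_mean : forall m, 0 <= m <= 1 -> is_mean (fam m);
  path0 : forall a b, 0 <= a -> 0 <= b -> fam 0 a b = b;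
  path1 : forall a b, 0 <= a -> 0 <= b -> fam 1 a b = a;
  path_half : forall a b, 0 <= a -> 0 <= b -> fam (1 / 2) a b = s a b;
  path_mid : forall m n a b, 0 <= m <= 1 -> 0 <= n <= 1 -> 0 <= a -> 0 <= b ->
    s (fam m a b) (fam n a b) = fam ((m + n) / 2) a b
}.

(* For bounded T, nonempty Omega and nonzero kernels the set below is nonempty
   and bounded, so that the real-valued [sup] is the usual supremum. *)
Definition mean_ber_norm (R : realType) (Omega : Type) (H : rkhs R Omega)
    (s : R -> R -> R) (p : R) (T : H -> H) : R :=
  sup (range (fun x : Omega =>
    (s (rnorm (inner H (T (nrkernel H x)) (nrkernel H x)) `^ p)
       (rnorm (T (nrkernel H x)) `^ p)) `^ p^-1)).

(* Main.v *)
(* Put [k] for a normalized kernel.  Buzano's inequality applied to [T k],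
   [T^* k] and the unit vector [k] gives
   [|<T k, k>|^2 <= (|T k| |T^* k| + |<T^2 k, k>|) / 2],
   and AM-GM bounds the product of norms by
   [(|T k|^2 + |T^* k|^2) / 2 = <(T^* T + T T^* ) k, k> / 2]; moreover
   [<|T|^2 k, k> = |T k|^2].  The claim follows since [sigma_mu] is monotone.
   The operators [T^*] and [|T|] exist by the Riesz representation theorem and
   by iterating [S <- (C + S^2) / 2] with [C = 1 - T^* T / M^2]. *)
Require Import Defs.
From HB Require Import structures.
From mathcomp Require Import all_boot all_order all_algebra.
From mathcomp Require Import sesquilinear.
From mathcomp Require Import all_classical all_reals all_analysis.
From mathcomp Require Import complex ring lra.
Set Implicit Arguments.
Unset Strict Implicit.
Unset Printing Implicit Defensive.
Import Order.TTheory GRing.Theory Num.Theory.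
Import numFieldNormedType.Exports.
Local Open Scope classical_set_scope.
Local Open Scope ring_scope.

(** * Complex numbers and real-valued norms *)

Section Complex.
Variable R : realType.
Implicit Types z w : R[i].
Local Notation Re := complex.Re.
Local Notation Im := complex.Im.
Local Open Scope complex_scope.

Lemma ReD z w : Re (z + w) = Re z + Re w.
Proof. by case: z; case: w. Qed.

Lemma ReN z : Re (- z) = - Re z.
Proof. by case: z. Qed.

Lemma ReB z w : Re (z - w) = Re z - Re w.
Proof. by rewrite ReD ReN. Qed.

Lemma Re_conj z : Re (Num.conj z) = Re z.
Proof. by case: z. Qed.

Lemma Re_realM (a : R) z : Re (a%:C * z) = a * Re z.
Proof. by case: z => x y /=; rewrite mul0r subr0. Qed.

Lemma Re_NiM z : Re (- 'i%C * z) = Im z.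
Proof. by case: z => x y /=; ring. Qed.

Lemma conj_realC (a : R) : Num.conj a%:C = a%:C :> R[i].
Proof. exact: conjc_real. Qed.

Lemma conj_eq_ImE z : Num.conj z = z -> Im z = 0.
Proof. by case: z => x y -[] /=; lra. Qed.

Section Norm.
Variable V : normedZmodType R[i].
Implicit Types u v : V.

Lemma norm_rnormC v : `|v| = (rnorm v)%:C.
Proof. by rewrite /rnorm RRe_real// normr_real. Qed.

Lemma rnorm_ge0 v : 0 <= rnorm v.
Proof. by rewrite -ler0c -norm_rnormC normr_ge0. Qed.

Lemma ler_rnormD u v : rnorm (u + v) <= rnorm u + rnorm v.
Proof. by rewrite -lecR rmorphD /= -!norm_rnormC ler_normD. Qed.

Lemma rnormN v : rnorm (- v) = rnorm v.
Proof. by rewrite /rnorm normrN. Qed.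

Lemma rnormB u v : rnorm (u - v) = rnorm (v - u).
Proof. by rewrite -rnormN opprB. Qed.

Lemma rnorm0_eq0 v : rnorm v = 0 -> v = 0.
Proof. by move=> v0; apply/eqP; rewrite -normr_eq0 norm_rnormC v0. Qed.

End Norm.

Section NormedModule.
Variable V : normedModType R[i].
Implicit Types v : V.

Lemma rnormZ a v : rnorm (a *: v) = rnorm a * rnorm v.
Proof.
by apply: (@complexI R); rewrite rmorphM /= -!norm_rnormC normrZ.
Qed.

Lemma cvg_rnormP (u : nat -> V) (l : V) :
  u n @[n --> \oo] --> l <->
  forall e : R, 0 < e -> \forall n \near \oo, rnorm (u n - l) < e.
Proof.
split=> [/cvgrPdist_lt ul e e0|ul].
  have e0' : 0 < e%:C by rewrite ltcR.
  apply: filterS (ul _ e0') => n; rewrite distrC.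
  by rewrite norm_rnormC ltcR.
apply/cvgrPdist_lt => -[e e'].
(* The order of [R[i]] compares only numbers with equal imaginary parts, so a positive radius is
   real. *)
rewrite ltcE /= => /andP[/eqP-> e0].
apply: filterS (ul _ e0) => n; rewrite distrC norm_rnormC.
by rewrite -ltcR.
Qed.

End NormedModule.

Lemma rnorm_realC (a : R) : rnorm a%:C = `|a|.
Proof. by rewrite /rnorm normc_def /= expr0n /= addr0 sqrtr_sqr. Qed.

Lemma rnormM z w : rnorm (z * w) = rnorm z * rnorm w.
Proof.
by apply: (@complexI R); rewrite rmorphM /= -!norm_rnormC normrM.
Qed.

Lemma rnorm_conj z : rnorm (Num.conj z) = rnorm z.
Proof. by rewrite /rnorm norm_conjC. Qed.

Lemma ler_Re_rnorm z : Re z <= rnorm z.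
Proof.
rewrite (le_trans (ler_norm _))// -lecR.
by have := normc_ge_Re z; rewrite norm_rnormC.
Qed.

End Complex.

Lemma complete_rnorm (R : realType) (V : completeNormedModType R[i])
    (u : nat -> V) :
  (forall e : R, 0 < e -> exists N, forall m n, (N <= m)%N -> (N <= n)%N ->
     rnorm (u m - u n) < e) ->
  exists l : V, u n @[n --> \oo] --> l.
Proof.
move=> uC; suff : cvg (u n @[n --> \oo]).
  by move=> ucv; exists (lim (u n @[n --> \oo])).
apply: cauchy_cvg; apply: cauchy_exP => -[e e'].
rewrite ltcE /= => /andP[/eqP-> e0].
have [N uN] := uC _ e0.
exists (u N); exists N => // n /= Nn.
by rewrite -ball_normE /= norm_rnormC ltcR uN.
Qed.

(** * Inner products: Cauchy-Schwarz, Buzano, continuity *)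

Section InnerProduct.
Variables (R : realType) (Omega : Type) (H : rkhs R Omega).
Implicit Types (e f g h : H) (a : R[i]).
Local Notation Re := complex.Re.
Local Notation "''[' f , g ]" := (inner H f g).
Local Open Scope complex_scope.

Lemma innerDl f g h : '[f + g, h] = '[f, h] + '[g, h].
Proof. exact: linearDl. Qed.

Lemma innerDr f g h : '[f, g + h] = '[f, g] + '[f, h].
Proof. exact: linearDr. Qed.

Lemma innerBl f g h : '[f - g, h] = '[f, h] - '[g, h].
Proof. exact: linearBl. Qed.

Lemma innerBr f g h : '[f, g - h] = '[f, g] - '[f, h].
Proof. exact: linearBr. Qed.

Lemma innerNr f g : '[f, - g] = - '[f, g].
Proof. exact: linearNr. Qed.

Lemma innerZl a f g : '[a *: f, g] = a * '[f, g].
Proof. exact: linearZl_LR. Qed.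

Lemma innerZr a f g : '[f, a *: g] = Num.conj a * '[f, g].
Proof. exact: linearZr_LR. Qed.

Lemma innerC f g : '[f, g] = Num.conj '[g, f].
Proof. by rewrite (hermC (inner H)) /= expr0 mul1r. Qed.

Lemma rnorm_inner_sym f g : rnorm '[f, g] = rnorm '[g, f].
Proof. by rewrite innerC rnorm_conj. Qed.

Lemma Re_inner_sym f g : Re '[f, g] = Re '[g, f].
Proof. by rewrite innerC Re_conj. Qed.

Lemma rnorm_sqr f : rnorm f ^+ 2 = Re '[f, f].
Proof. by rewrite -rkhs_normE norm_rnormC -rmorphXn. Qed.

Lemma inner_diag f : '[f, f] = (rnorm f ^+ 2)%:C.
Proof. by rewrite -rkhs_normE norm_rnormC -rmorphXn. Qed.

Lemma rnorm_sqrD f g :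
  rnorm (f + g) ^+ 2 = rnorm f ^+ 2 + rnorm g ^+ 2 + 2 * Re '[f, g].
Proof.
rewrite !rnorm_sqr innerDl !innerDr !ReD (Re_inner_sym g f); ring.
Qed.

Lemma inner_ext f g : (forall h, '[h, f] = '[h, g]) -> f = g.
Proof.
move=> fg; apply/eqP; rewrite -subr_eq0; apply/eqP; apply: rnorm0_eq0.
by apply/eqP; rewrite -sqrf_eq0 rnorm_sqr innerBr fg subrr.
Qed.

Lemma cauchy_schwarz f g : rnorm '[f, g] <= rnorm f * rnorm g.
Proof.
have [->|g0] := eqVneq g 0.
  by rewrite linear0r (_ : rnorm 0 = 0) ?mulr_ge0 ?rnorm_ge0// /rnorm normr0.
have ng : 0 < rnorm g.
  rewrite lt_neqAle rnorm_ge0 andbT eq_sym.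
  by apply: contra g0 => /eqP/rnorm0_eq0/eqP.
(* This vector is [|g|^2] times the component of [f] orthogonal to [g]; its squared norm is
   [|g|^2 (|f|^2 |g|^2 - |<f, g>|^2)]. *)
have := sqr_ge0 (rnorm ((rnorm g ^+ 2)%:C *: f - '[f, g] *: g)).
rewrite rnorm_sqrD rnormN !rnormZ innerZl innerNr innerZr/=.
rewrite mulrN ReN Re_realM (mulrC (Num.conj _)) -normCK norm_rnormC.
rewrite -rmorphXn /= rnorm_realC.
rewrite (ger0_norm (sqr_ge0 _)).
set b := rnorm g in ng *; set c := rnorm '[f, g]; set x := rnorm f => ineq.
have b2 : 0 < b ^+ 2 by rewrite exprn_gt0.
have : 0 <= b ^+ 2 * ((x * b) ^+ 2 - c ^+ 2).
  by rewrite [leRHS](_ : _ = (b ^+ 2 * x) ^+ 2 + (c * b) ^+ 2 +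
    2 * - (b ^+ 2 * c ^+ 2)); last by ring.
rewrite pmulr_rge0// subr_ge0 ler_pXn2r// nnegrE ?rnorm_ge0//.
by rewrite mulr_ge0 ?rnorm_ge0.
Qed.

(* [2 <f, e> e - f] is the image of [f] under a reflection, so it has the norm
   of [f]. *)
Lemma buzano e f g : rnorm e = 1 ->
  rnorm '[f, e] * rnorm '[e, g] <=
  1 / 2 * (rnorm f * rnorm g + rnorm '[f, g]).
Proof.
move=> e1.
pose r := (2 * '[f, e]) *: e - f.
have rf : rnorm r = rnorm f.
  apply/eqP; rewrite -(@eqrXn2 _ 2)// ?rnorm_ge0// /r rnorm_sqrD rnormN.
  rewrite rnormZ rnormM e1 innerNr innerZl /= ReN (innerC e f) -(mulrA 2).
  rewrite -(rmorph_nat (real_complex R) 2) -normCK norm_rnormC -rmorphXn.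
  by rewrite Re_realM rnorm_realC ger0_norm ?ler0n//=; apply/eqP; ring.
have fe : 2 * ('[f, e] * '[e, g]) = '[r, g] + '[f, g].
  by rewrite innerBl innerZl /= subrK mulrA.
have := cauchy_schwarz r g; rewrite rf.
have := ler_rnormD ('[r, g] : R[i]) '[f, g]; rewrite -fe !rnormM.
rewrite -(rmorph_nat (real_complex R) 2) rnorm_realC ger0_norm ?ler0n//=.
lra.
Qed.

Lemma cvg_inner_l (u : nat -> H) f g :
  u n @[n --> \oo] --> f -> '[u n, g] @[n --> \oo] --> '[f, g].
Proof.
move=> /cvg_rnormP uf; apply/cvg_rnormP => e e0.
(* The added 1 keeps the divisor positive when [g = 0]. *)
have g0 : 0 < rnorm g + 1 by rewrite ltr_wpDl ?rnorm_ge0.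
apply: filterS (uf (e / (rnorm g + 1)) (divr_gt0 e0 g0)) => n.
rewrite ltr_pdivlMr// => un.
rewrite -innerBl; apply: le_lt_trans (cauchy_schwarz _ _) (le_lt_trans _ un).
by rewrite ler_wpM2l ?rnorm_ge0// lerDl.
Qed.

Lemma cvg_inner_r (u : nat -> H) f g :
  u n @[n --> \oo] --> f -> '[g, u n] @[n --> \oo] --> '[g, f].
Proof.
move=> /(cvg_inner_l (g := g))/cvg_rnormP uf; apply/cvg_rnormP => e e0.
by apply: filterS (uf e e0) => n; rewrite -innerBl -innerBr rnorm_inner_sym.
Qed.

End InnerProduct.

(** * The Riesz representation theorem *)

Section Riesz.
Variables (R : realType) (Omega : Type) (H : rkhs R Omega).
Variables (phi : {scalar H}) (M : R).
Hypothesis phi_bounded : forall f : H, rnorm (phi f) <= M * rnorm f.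
Implicit Types f g h : H.
Local Notation Re := complex.Re.
Local Open Scope complex_scope.

(* The minimizer of this functional is the representing vector. *)
Let J f : R := rnorm f ^+ 2 - 2 * Re (phi f).

Let ReZ (t : R) f : Re (phi (t%:C *: f)) = t * Re (phi f).
Proof. by rewrite linearZ /= Re_realM. Qed.

(** Since [Re (phi f) <= M |f|], completing the square leaves [(|f| - M)^2 - M^2]. *)
Let J_ge f : - M ^+ 2 <= J f.
Proof.
have := le_trans (ler_Re_rnorm _) (phi_bounded f).
rewrite /J; have := sqr_ge0 (rnorm f - M); nra.
Qed.

Let infJ := inf (range J).

Let J_hasinf : has_inf (range J).
Proof.
by split; [exists (J 0), 0|exists (- M ^+ 2) => _ [f _ <-]; exact: J_ge].
Qed.

Let infJ_le f : infJ <= J f.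
Proof. by apply: ge_inf; [case: J_hasinf|exists f]. Qed.

Let J_translate f h (t : R) :
  J (f + t%:C *: h) =
  J f + 2 * t * (Re (inner H f h) - Re (phi h)) + t ^+ 2 * rnorm h ^+ 2.
Proof.
rewrite /J rnorm_sqrD linearD ReD ReZ innerZr conj_realC Re_realM rnormZ.
rewrite rnorm_realC exprMn real_normK ?num_real//; ring.
Qed.

(** At the midpoint of [f] and [g], [J] equals [(J f + J g) / 2 - |f - g|^2 / 4], and this is at
    least [infJ]. Minimizing sequences are therefore Cauchy. *)
Let J_parallelogram f g :
  rnorm (f - g) ^+ 2 <= 2 * (J f - infJ) + 2 * (J g - infJ).
Proof.
have := infJ_le (f + (1 / 2)%:C *: (g - f)).
have -> : f - g = - (g - f) by rewrite opprB.
rewrite rnormN.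
have Jg : J g = J (f + 1%:C *: (g - f)) by rewrite scale1r addrCA subrr addr0.
move: Jg; rewrite !J_translate; set x := _ - Re _; set d := rnorm _.
lra.
Qed.

Let minimizing_sequence : exists u : nat -> H,
  forall n, J (u n) <= infJ + n.+1%:R^-1.
Proof.
have /choice[u uJ] : forall n, exists f, J f <= infJ + n.+1%:R^-1.
  move=> n; have n0 : 0 < n.+1%:R^-1 :> R by rewrite invr_gt0.
  by have [_ [f _ <-] /ltW Jf] := inf_adherent n0 J_hasinf; exists f.
by exists u.
Qed.

(** An approximate Euler equation: compare [infJ] with [J (f + e h)], expand, and divide by [e]. *)
Let nearly_minimal f h (e : R) : 0 < e -> J f <= infJ + e ^+ 2 ->
  Re (phi h) - Re (inner H f h) <= e * (1 + rnorm h ^+ 2).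
Proof.
move=> e0 Jf; rewrite -(ler_pM2l e0).
have := infJ_le (f + e%:C *: h); rewrite J_translate.
have := mulr_ge0 (sqr_ge0 e) (sqr_ge0 (rnorm h)); have := sqr_ge0 e.
nra.
Qed.

Lemma riesz : exists k : H, forall f, phi f = inner H f k.
Proof.
have [u uJ] := minimizing_sequence.
have small (e : R) : 0 < e -> exists N, forall n, (N <= n)%N -> n.+1%:R^-1 < e.
  move=> e0; have [N _ NP] := near_infty_natSinv_lt (PosNum e0).
  by exists N => n; exact: NP.
(* Two gaps to [infJ] below [e^2 / 4], each with weight 2 in [J_parallelogram], give
   [|u m - u n|^2 < e^2]. *)
have [e e0|k uk] := @complete_rnorm R H u.
  have [N NP] := small (e ^+ 2 / 4) ltac:(rewrite divr_gt0// exprn_gt0//).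
  exists N => m n Nm Nn.
  rewrite -(@ltr_pXn2r _ 2)// ?nnegrE ?rnorm_ge0// ?(ltW e0)//.
  apply: le_lt_trans (J_parallelogram _ _) _.
  have := uJ m; have := uJ n; have := NP _ Nm; have := NP _ Nn.
  move: (n.+1%:R^-1) (m.+1%:R^-1) (J _) (J _) => *; lra.
have Re_phi h : Re (phi h) <= Re (inner H k h).
  apply/ler_addgt0Pr => e e0.
  have h0 : 0 < 1 + rnorm h ^+ 2 by rewrite ltr_pwDl// sqr_ge0.
  (* With this tolerance the error in [nearly_minimal] is exactly [e / 2]; the other half pays for
     replacing [u n] by [k]. *)
  have d0 : 0 < e / 2 / (1 + rnorm h ^+ 2) by rewrite !divr_gt0.
  have [N1 NP1] := small _ (exprn_gt0 2 d0).
  have [N2 _ NP2] := (cvg_rnormP _ _).1 (cvg_inner_l (g := h) uk) (e / 2)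
    ltac:(rewrite divr_gt0//).
  have := NP2 (maxn N1 N2) (leq_maxr _ _).
  have := NP1 (maxn N1 N2) (leq_maxl _ _).
  set n := maxn _ _ => n1 n2.
  have Jn : J (u n) <= infJ + (e / 2 / (1 + rnorm h ^+ 2)) ^+ 2.
    by apply: le_trans (uJ n) _; rewrite lerD2l ltW.
  have := nearly_minimal h d0 Jn.
  rewrite divfK ?gt_eqF//.
  have := le_lt_trans (ler_Re_rnorm _) n2; rewrite ReB; lra.
have Re_phiE h : Re (phi h) = Re (inner H h k).
  rewrite Re_inner_sym; apply/eqP; rewrite eq_le Re_phi /=.
  by have := Re_phi (- h); rewrite raddfN innerNr !ReN lerN2.
(* The imaginary parts agree because [Im z = Re (- i z)]: apply the identity of real parts to
   [- i f]. *)
exists k => f; apply/eqP; rewrite eq_complex Re_phiE eqxx /=.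
by rewrite -!Re_NiM -innerZl -Re_phiE linearZ.
Qed.

End Riesz.

(** * Square roots by iteration for a self-adjoint contraction *)

Section ContractionSquareRoot.
Variables (R : realType) (Omega : Type) (H : rkhs R Omega) (C : H -> H).
Hypothesis C_linear : linear C.
Hypothesis C_selfadjoint : forall f g, inner H (C f) g = inner H f (C g).
Hypothesis C_contraction : forall f, rnorm (C f) <= rnorm f.
Implicit Types (f g : H) (D E : H -> H) (d e : R).
Local Open Scope complex_scope.
Local Notation "''[' f , g ]" := (inner H f g).

(* [poly_in C D d] says that [D = P C] and [d = P 1] for some polynomial [P]
   with nonnegative coefficients; hence [d] bounds the norm of [D]. *)
Inductive poly_in : (H -> H) -> R -> Prop :=
| poly_in_gen : poly_in C 1
| poly_in_zero : poly_in (fun=> 0) 0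
| poly_in_scale a D d :
    0 <= a -> poly_in D d -> poly_in (fun f => a%:C *: D f) (a * d)
| poly_in_add D d E e :
    poly_in D d -> poly_in E e -> poly_in (fun f => D f + E f) (d + e)
| poly_in_comp D d E e :
    poly_in D d -> poly_in E e -> poly_in (fun f => D (E f)) (d * e).

Lemma poly_in_ext D D' d d' : D =1 D' -> d = d' -> poly_in D d -> poly_in D' d'.
Proof. by move=> /funext <- <-. Qed.

Lemma poly_in_linear D d : poly_in D d -> linear D.
Proof.
elim=> {D d} [//|a f g|a D d _ _ DL a' f g|D d E e _ DL _ EL a f g|
  D d E e _ DL _ EL a f g].
- by rewrite scaler0 addr0.
- by rewrite DL scalerDr !scalerA mulrC.
- by rewrite DL EL scalerDr addrACA.
- by rewrite EL DL.
Qed.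

Lemma poly_inB D d f g : poly_in D d -> D (f - g) = D f - D g.
Proof. by move=> /poly_in_linear/zmod_morphism_linear ->. Qed.

Lemma poly_in_bound D d f : poly_in D d -> 0 <= d /\ rnorm (D f) <= d * rnorm f.
Proof.
move=> Dd; elim: Dd f => {D d} [|f|a D d a0 _ IH f|D d E e _ IHD _ IHE f|
  D d E e _ IHD _ IHE f].
- by move=> f; rewrite ler01 mul1r.
- by rewrite lexx mul0r /rnorm normr0.
- have [d0 Df] := IH f.
  split; first exact: mulr_ge0.
  by rewrite rnormZ rnorm_realC ger0_norm// -mulrA ler_wpM2l.
- have [d0 Df] := IHD f; have [e0 Ef] := IHE f.
  split; first exact: addr_ge0.
  by rewrite mulrDl (le_trans (ler_rnormD _ _))// lerD.
- have [e0 Ef] := IHE f; have [d0 DEf] := IHD (E f).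
  split; first exact: mulr_ge0.
  by rewrite (le_trans DEf)// -mulrA ler_wpM2l.
Qed.

Lemma poly_in_ge0 D d : poly_in D d -> 0 <= d.
Proof. by move=> /(poly_in_bound 0)[]. Qed.

Lemma poly_in_commute_with D d E :
  linear E -> (forall f, E (C f) = C (E f)) -> poly_in D d ->
  forall f, E (D f) = D (E f).
Proof.
move=> E_linear EC; elim=> {D d} [|f|a D d _ _ IH f|D d D' d' _ IHD _ IHD' f|
  D d D' d' _ IHD _ IHD' f].
- exact: EC.
- have /zmod_morphism_linear EB := E_linear.
  by rewrite -[in LHS](subrr (0 : H)) EB subrr.
- by have /scalable_linear EZ := E_linear; rewrite EZ IH.
- by have := E_linear 1 (D f) (D' f); rewrite !scale1r IHD IHD'.
- by rewrite IHD IHD'.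
Qed.

Lemma poly_in_commute D d E e f :
  poly_in D d -> poly_in E e -> E (D f) = D (E f).
Proof.
move=> Dd Ee; apply: poly_in_commute_with Dd _ => [|{}f].
  exact: poly_in_linear Ee.
(* That [E] commutes with [C] is the same lemma, with [C] now as the outer operator. *)
by symmetry; apply: poly_in_commute_with Ee _.
Qed.

Lemma poly_in_selfadjoint D d f g :
  poly_in D d -> inner H (D f) g = inner H f (D g).
Proof.
move=> Dd; elim: Dd f g => {D d} [//|f g|a D d _ _ IH f g|
  D d E e _ IHD _ IHE f g|D d E e Dd IHD Ee IHE f g].
- by rewrite linear0l linear0r.
- by rewrite innerZl innerZr conj_realC IH.
- by rewrite innerDl innerDr IHD IHE.
- by rewrite IHD IHE (poly_in_commute _ Dd Ee).
Qed.

(* If [C = 1 - B], the limit [S] of this iteration satisfies [(1 - S)^2 = B];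
   [majorant] is the same iteration for the scalar [C = 1]. *)
Fixpoint approx n f : H :=
  if n is n'.+1 then (1 / 2)%:C *: (C f + approx n' (approx n' f)) else 0.

Fixpoint majorant n : R :=
  if n is n'.+1 then 1 / 2 * (1 + majorant n' * majorant n') else 0.

Lemma poly_in_approx n : poly_in (approx n) (majorant n).
Proof.
elim: n => [|n IH]; first exact: poly_in_zero.
apply: poly_in_scale; first lra.
by apply: poly_in_add; [exact: poly_in_gen|exact: poly_in_comp].
Qed.

(** Write [A_n] for [approx n]. As these commute, a difference of squares factors:
    [A_(n+2) - A_(n+1)] is half of [(A_(n+1) + A_n) (A_(n+1) - A_n)], so nonnegative coefficients
    persist. Operator increments are thus bounded by scalar ones. *)
Lemma poly_in_step n :
  poly_in (fun f => approx n.+1 f - approx n f) (majorant n.+1 - majorant n).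
Proof.
have half_ge0 : 0 <= 1 / 2 :> R by lra.
elim: n => [|n IH].
  apply: poly_in_ext (poly_in_scale half_ge0 poly_in_gen) => [f|] /=.
    by rewrite addr0 subr0.
  by ring.
have An := poly_in_approx n; have An1 := poly_in_approx n.+1.
apply: poly_in_ext (poly_in_scale half_ge0
  (poly_in_add (poly_in_comp An1 IH) (poly_in_comp An IH))) => [f|].
  rewrite (poly_inB _ _ An1) (poly_inB _ _ An) (poly_in_commute _ An1 An).
  rewrite addrA subrK [approx n.+2]/= [in RHS]/= -scalerBr.
  by congr (_ *: _); rewrite opprD addrACA subrr add0r.
rewrite [majorant n.+2]/=.
have -> : majorant n.+1 = 1 / 2 * (1 + majorant n * majorant n) by [].
ring.
Qed.

Lemma poly_in_steps n k :
  poly_in (fun f => approx (k + n) f - approx n f)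
    (majorant (k + n) - majorant n).
Proof.
elim: k => [|k IH].
  by apply: poly_in_ext poly_in_zero => [f|]; rewrite subrr.
apply: poly_in_ext (poly_in_add (poly_in_step (k + n)) IH) => [f|].
  by rewrite addrA subrK.
by rewrite addrA subrK.
Qed.

Lemma majorant_le1 n : majorant n <= 1.
Proof.
elim: n => [|n IH] /=; first exact: ler01.
by have := poly_in_ge0 (poly_in_approx n); nra.
Qed.

(** The sequence increases and is bounded; from the first index with a value within [e] of the
    supremum on, no term at all exceeds it by [e], whence [m] is arbitrary. *)
Lemma majorant_cauchy (e : R) : 0 < e ->
  exists N, forall m n, (N <= n)%N -> majorant m - majorant n < e.
Proof.
move=> e0; have majorant_bounded : has_sup (range majorant).
  split; first by exists (majorant 0), 0.
  by exists 1 => _ [n _ <-]; exact: majorant_le1.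
have [_ [N _ <-] aN] := sup_adherent e0 majorant_bounded.
exists N => m n /subnK <-.
have := poly_in_ge0 (poly_in_steps N (n - N)).
have : majorant m <= sup (range majorant).
  by apply: sup_upper_bound => //; exists m.
move: aN; lra.
Qed.

Lemma approx_cauchy f (e : R) : 0 < e ->
  exists N, forall m n, (N <= m)%N -> (N <= n)%N ->
    rnorm (approx m f - approx n f) < e.
Proof.
move=> e0; have f0 : 0 < rnorm f + 1 by rewrite ltr_wpDl ?rnorm_ge0.
have [N NP] := majorant_cauchy (divr_gt0 e0 f0).
exists N => m n Nm Nn.
wlog nm : m n Nm Nn / (n <= m)%N.
  by move=> W; case: (leqP n m) => [|/ltnW] nm; [|rewrite rnormB]; apply: W.
have := NP m n Nn; rewrite ltr_pdivlMr//; apply: le_lt_trans.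
have [] := poly_in_bound f (poly_in_steps n (m - n)); rewrite subnK// => y0.
by move/le_trans; apply; rewrite ler_wpM2l// lerDl.
Qed.

(** [S] is the pointwise limit of [approx], from which it inherits linearity, symmetry and the norm
    bound. The equation arises from two limits of the shifted sequence [approx n.+1 f]. *)
Lemma contraction_sqrt : exists S : H -> H,
  [/\ linear S, forall f g, inner H (S f) g = inner H f (S g),
      forall f, rnorm (S f) <= rnorm f &
      forall f, S f = (1 / 2)%:C *: (C f + S (S f))].
Proof.
have /choice[S SP] : forall f, exists l : H, approx n f @[n --> \oo] --> l.
  by move=> f; apply: complete_rnorm (approx_cauchy f).
have approx_contraction n f : rnorm (approx n f) <= rnorm f.
  have [_ /le_trans->//] := poly_in_bound f (poly_in_approx n).
  by rewrite ler_piMl ?rnorm_ge0// majorant_le1.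
exists S; split=> [a f g|f g|f|f].
- apply: (norm_cvg_unique (SP _)).
  rewrite (_ : (fun n => _) = (fun n => a *: approx n f + approx n g)).
    by apply: cvgD; [apply: cvgZr; exact: SP|exact: SP].
  by apply/funext => n; rewrite (poly_in_linear (poly_in_approx n)).
- have Sf_cvg := cvg_inner_l (g := g) (SP f).
  have fS_cvg : '[approx n f, g] @[n --> \oo] --> '[f, S g].
    rewrite (_ : (fun n => _) = (fun n => '[f, approx n g])).
      by apply: cvg_inner_r; exact: SP.
    by apply/funext => n; rewrite (poly_in_selfadjoint _ _ (poly_in_approx n)).
  exact: (@norm_cvg_unique (R[i] : numFieldType) (R[i] : numFieldType)
    _ _ _ _ Sf_cvg fS_cvg).
- apply/ler_addgt0Pr => e e0.
  have [N _ NP] := (cvg_rnormP _ _).1 (SP f) e e0.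
  have := NP N (leqnn N); rewrite /= rnormB => /ltW SA.
  rewrite -(subrK (approx N f) (S f)) addrC (le_trans (ler_rnormD _ _))//.
  by rewrite lerD.
- have S_cvg : approx n.+1 f @[n --> \oo] --> S f.
    apply/cvg_rnormP => e e0.
    have [N _ NP] := (cvg_rnormP _ _).1 (SP f) e e0.
    by exists N => // n /= Nn; exact: (NP n.+1 (leqW Nn)).
  apply: (norm_cvg_unique S_cvg) => /=.
  apply: cvgZr; apply: cvgD; first exact: cvg_cst.
  (* Insert [approx n (S f)]: one difference is [approx n] applied to [approx n f - S f], which the
     contraction bound controls; the other is convergence at [S f]. *)
  apply/cvg_rnormP => e e0; have e20 : 0 < e / 2 by rewrite divr_gt0.
  have Af := (cvg_rnormP _ _).1 (SP f) _ e20.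
  have ASf := (cvg_rnormP _ _).1 (SP (S f)) _ e20.
  apply: filterS2 Af ASf => n Af ASf.
  rewrite -(subrKA (approx n (S f))) (splitr e).
  rewrite (le_lt_trans (ler_rnormD _ _))//.
  rewrite ltrD// -(poly_inB _ _ (poly_in_approx n)).
  by rewrite (le_lt_trans (approx_contraction _ _)).
Qed.

End ContractionSquareRoot.

(** * The adjoint and the absolute value of a bounded operator *)

Section Operators.
Variables (R : realType) (Omega : Type) (H : rkhs R Omega).
Variable T : {linear H -> H}.
Implicit Types f g : H.
Local Notation Re := complex.Re.
Local Notation Im := complex.Im.
Local Notation "''[' f , g ]" := (inner H f g).
Local Open Scope complex_scope.

(** Named so that it can carry the linear structure that [riesz] asks of a functional. *)
Definition inner_comp g f : R[i] := '[T f, g].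

Lemma inner_comp_scalar g : scalar (inner_comp g).
Proof. by move=> a f h; rewrite /inner_comp linearP innerDl innerZl. Qed.

HB.instance Definition _ g :=
  GRing.isLinear.Build R[i] H R[i] *%R (inner_comp g) (inner_comp_scalar g).

(** A bound that is at least 1 may be divided by, as in [1 - T^* T / M^2]. *)
Lemma bounded_op_ge1 : bounded_op T ->
  exists2 M : R, 1 <= M & forall f, rnorm (T f) <= M * rnorm f.
Proof.
move=> [M TM]; exists (Num.max 1 M) => [|f]; first by rewrite le_max lexx.
by rewrite (le_trans (TM f))// ler_wpM2r ?rnorm_ge0// le_max lexx orbT.
Qed.

Variable M : R.
Hypotheses (M_ge1 : 1 <= M) (T_bound : forall f, rnorm (T f) <= M * rnorm f).

Let M_gt0 : 0 < M. Proof. exact: lt_le_trans M_ge1. Qed.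

(** Riesz, applied for each [h] to [f |-> <T f, h>], yields an adjoint, which rules out the default
    of [xget]. *)
Lemma adjointP f g : '[T f, g] = '[f, adjoint T g].
Proof.
rewrite /adjoint; case: xgetP => [S _ -> //|noS].
have phi_bounded h f' : rnorm (inner_comp h f') <= M * rnorm h * rnorm f'.
  rewrite (le_trans (cauchy_schwarz _ _))// mulrAC ler_wpM2r ?rnorm_ge0//.
have /choice[S SP] h := riesz (phi_bounded h).
by have /= := noS S; case=> f' h; exact: SP.
Qed.

Lemma adjoint_linear : linear (adjoint T).
Proof.
move=> a f g; apply: inner_ext => h.
by rewrite innerDr innerZr -!adjointP innerDr innerZr.
Qed.

(** [|T^* g|^2 = <T T^* g, g> <= M |T^* g| |g|]; cancel [|T^* g|] unless it vanishes. *)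
Lemma adjoint_bound g : rnorm (adjoint T g) <= M * rnorm g.
Proof.
have := cauchy_schwarz (T (adjoint T g)) g.
rewrite adjointP inner_diag rnorm_realC ger0_norm ?sqr_ge0// => bound.
have [->|] := eqVneq (rnorm (adjoint T g)) 0.
  by rewrite mulr_ge0 ?rnorm_ge0// ltW.
move=> Tg0; have Tg_gt0 : 0 < rnorm (adjoint T g).
  by rewrite lt_neqAle eq_sym Tg0 rnorm_ge0.
rewrite -(ler_pM2l Tg_gt0) -expr2 (le_trans bound)// mulrA.
rewrite ler_wpM2r ?rnorm_ge0//.
by rewrite mulrC.
Qed.

Lemma inner_adjoint_comp f g : '[adjoint T (T f), g] = '[T f, T g].
Proof. by rewrite innerC -adjointP -innerC. Qed.

Let C f : H := f - (M ^- 2)%:C *: adjoint T (T f).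

Let C_linear : linear C.
Proof.
move=> a f g; rewrite /C linearP adjoint_linear scalerDr scalerBr !scalerA.
by rewrite (mulrC _ a) opprD addrACA.
Qed.

Let C_selfadjoint f g : '[C f, g] = '[f, C g].
Proof.
rewrite innerBl innerBr innerZl innerZr conj_realC.
by rewrite inner_adjoint_comp adjointP.
Qed.

(** In [|C f|^2 = |f|^2 - 2 |T f|^2 / M^2 + |T^* T f|^2 / M^4] the last term is at most
    [|T f|^2 / M^2], by [adjoint_bound]. *)
Let C_contraction f : rnorm (C f) <= rnorm f.
Proof.
have M2 : 0 < M ^+ 2 by rewrite exprn_gt0.
rewrite -(@ler_pXn2r _ 2)// ?nnegrE ?rnorm_ge0//.
rewrite rnorm_sqrD rnormN rnormZ rnorm_realC ger0_norm ?invr_ge0 ?(ltW M2)//.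
rewrite innerNr innerZr conj_realC ReN Re_realM -adjointP -rnorm_sqr.
rewrite exprMn.
have TTf : rnorm (adjoint T (T f)) ^+ 2 <= M ^+ 2 * rnorm (T f) ^+ 2.
  rewrite -exprMn ler_pXn2r// ?nnegrE ?mulr_ge0 ?rnorm_ge0 ?(ltW M_gt0)//.
  exact: adjoint_bound.
have : (M ^- 2) ^+ 2 * rnorm (adjoint T (T f)) ^+ 2 <=
   M ^- 2 * rnorm (T f) ^+ 2.
  rewrite [_ ^- 2 ^+ 2]expr2 -mulrA ler_pM2l ?invr_gt0//.
  by rewrite ler_pdivrMl.
have : 0 <= M ^- 2 * rnorm (T f) ^+ 2.
  by rewrite mulr_ge0 ?invr_ge0 ?sqr_ge0.
lra.
Qed.

(** The root is [M (1 - S)]: from [2 S = C + S^2] follows [(1 - S)^2 = 1 - C = T^* T / M^2]. *)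
Lemma positive_sqrt : exists A : H -> H,
  positive_op A /\ forall f, A (A f) = adjoint T (T f).
Proof.
have [S [S_linear S_sa S_contr SE]] :=
  contraction_sqrt C_linear C_selfadjoint C_contraction.
have S_zmod := zmod_morphism_linear S_linear.
have S_scal := scalable_linear S_linear.
exists (fun f => M%:C *: (f - S f)); split; last first.
  move=> f; rewrite S_scal S_zmod -scalerBr scalerA -rmorphM.
  have -> : f - S f - (S f - S (S f)) = (M ^- 2)%:C *: adjoint T (T f).
    have -> : (M ^- 2)%:C *: adjoint T (T f) = f - C f by rewrite /C subKr.
    have SS : C f + S (S f) = S f + S f.
      rewrite -[LHS]scale1r; have -> : 1 = (1 / 2 + 1 / 2)%:C :> R[i].
        by congr _%:C; lra.
      by rewrite rmorphD scalerDl -SE.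
    have -> : C f = S f + S f - S (S f) by rewrite -SS addrK.
    by rewrite !opprD !opprK !addrA.
  rewrite scalerA -rmorphM /= -expr2 divff ?scale1r//.
  by rewrite gt_eqF// exprn_gt0.
split=> [a f g||f].
- rewrite S_linear scalerA mulrC -scalerA -scalerDr; congr (_ *: _).
  by rewrite scalerBr opprD addrACA.
- exists (M * 2) => f; rewrite rnormZ rnorm_realC ger0_norm ?(ltW M_gt0)//.
  rewrite -mulrA ler_pM2l// (le_trans (ler_rnormD _ _))// rnormN.
  by have := S_contr f; lra.
(* Comparison in [R[i]] also demands equal imaginary parts: [<S f, f>] is real as [S] is
   self-adjoint. *)
- rewrite innerZl innerBl mulr_ge0 ?ler0c ?(ltW M_gt0)// subr_ge0 lecE.
  rewrite inner_diag (conj_eq_ImE (z := '[S f, f])) ?eqxx /=.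
    rewrite (le_trans (ler_Re_rnorm _))// (le_trans (cauchy_schwarz _ _))//.
    by rewrite expr2 ler_wpM2r ?rnorm_ge0.
  by rewrite -innerC S_sa.
Qed.

Lemma abs_opP f : abs_op T (abs_op T f) = adjoint T (T f).
Proof.
rewrite /abs_op; case: xgetP => [A _ [_ ->] //|noA].
by have [A AP] := positive_sqrt; case: (noA A AP).
Qed.

End Operators.

(** * An upper bound for means *)

Section Means.
Variables (R : realType) (s : R -> R -> R).
Hypothesis s_mean : is_mean s.
Implicit Types a b c : R.

Lemma mean_le a b c : 0 <= a -> 0 <= b -> a <= c -> b <= c -> s a b <= c.
Proof.
move=> a0 b0 ac bc; have c0 := le_trans a0 ac.
have [_] := mean_between s_mean c0 (lexx c); apply: le_trans.
by apply: le_trans (mean_homol s_mean _ ac _) (mean_homor s_mean _ _ bc).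
Qed.

End Means.

(** * Estimates at a unit vector *)

Section UnitVectors.
Variables (R : realType) (Omega : Type) (H : rkhs R Omega).
Variables (T : {linear H -> H}) (M : R).
Hypotheses (M_ge1 : 1 <= M) (T_bound : forall f, rnorm (T f) <= M * rnorm f).
Variable k : H.
Hypothesis k_unit : rnorm k = 1.
Local Notation Re := complex.Re.
Local Notation "''[' f , g ]" := (inner H f g).

Local Notation bound :=
  (1 / 4 * Re '[adjoint T (T k) + T (adjoint T k), k]
   + 1 / 2 * rnorm '[T (T k), k]).

Let bound_normE : bound =
  1 / 4 * (rnorm (T k) ^+ 2 + rnorm (adjoint T k) ^+ 2)
  + 1 / 2 * rnorm '[T (T k), k].
Proof.
rewrite innerDl ReD (inner_adjoint_comp T_bound).
by rewrite (adjointP T_bound (adjoint T k)) !rnorm_sqr.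
Qed.

Lemma inner_unit_sqr_le : rnorm '[T k, k] ^+ 2 <= bound.
Proof.
rewrite bound_normE.
(* Here [<k, T^* k> = <T k, k>] and [<T k, T^* k> = <T^2 k, k>]. *)
have := buzano (T k) (adjoint T k) k_unit.
rewrite -!(adjointP T_bound) -expr2.
have := sqr_ge0 (rnorm (T k) - rnorm (adjoint T k)); nra.
Qed.

(** Serves to bound the right-hand set of the theorem; the terms contribute [M^2 / 2] each. *)
Lemma bound_le : bound <= M ^+ 2.
Proof.
have M0 : 0 <= M by rewrite (le_trans _ M_ge1).
rewrite bound_normE.
have := T_bound k; have := adjoint_bound M_ge1 T_bound k.
rewrite k_unit mulr1 => Tk1 Tk2.
have := cauchy_schwarz (T k) (adjoint T k).
rewrite -(adjointP T_bound).
have := rnorm_ge0 (T k); have := rnorm_ge0 (adjoint T k); nra.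
Qed.

Lemma abs_op_sqr_unit : Re '[abs_op T (abs_op T k), k] = rnorm (T k) ^+ 2.
Proof.
by rewrite (abs_opP M_ge1 T_bound) (inner_adjoint_comp T_bound) rnorm_sqr.
Qed.

Lemma rnorm_unit_le : rnorm (T k) <= M.
Proof. by have := T_bound k; rewrite k_unit mulr1. Qed.

End UnitVectors.

(** * Powers, normalized kernels and the passage to suprema *)

Lemma powR_half (R : realType) (a p : R) : 0 <= a ->
  (a ^+ 2) `^ (p / 2) = a `^ p.
Proof.
by move=> a0; rewrite -powR_mulrn// -powRrM mulrCA divff ?mulr1// pnatr_eq0.
Qed.

Lemma rnorm_nrkernel (R : realType) (Omega : Type) (H : rkhs R Omega)
    (x : Omega) : rkernel H x != 0 -> rnorm (nrkernel H x) = 1.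
Proof.
by move=> kx; rewrite /rnorm normrZ normfV normr_id mulVf ?normr_eq0.
Qed.

(* The inner products under [complex.Re] are real and nonnegative, and the set
   on the right is bounded, so that [sup] is the usual supremum. *)
Theorem theorem2p28 (R : realType) (Omega : Type)
    (Omega_neq0 : [set: Omega] !=set0)
    (H : rkhs R Omega) (rkernel_neq0 : forall x : Omega, rkernel H x != 0)
    (T : {linear H -> H}) (T_bounded : bounded_op T)
    (mu : R) (mu01 : 0 <= mu <= 1)
    (sigma : R -> R -> R) (sigma_sym : is_symmetric_mean sigma)
    (sigma_ : R -> R -> R -> R)
    (sigma_path : is_interpolation_path sigma sigma_)
    (p : R) (p_ge1 : 1 <= p) :
  mean_ber_norm (sigma_ mu) p T `^ p <=
  sup (range (fun x : Omega =>
    let k := nrkernel H x in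
    sigma_ mu
      ((1 / 4 * complex.Re (inner H (adjoint T (T k) + T (adjoint T k)) k)
        + 1 / 2 * rnorm (inner H (T (T k)) k)) `^ (p / 2))
      (complex.Re (inner H (abs_op T (abs_op T k)) k) `^ (p / 2)))).
Proof.
have sm_mean := path_mean sigma_path mu01.
have [M M_ge1 T_bound] := bounded_op_ge1 T_bounded.
have M_ge0 : 0 <= M by exact: le_trans M_ge1.
have p2_ge0 : 0 <= p / 2 by rewrite divr_ge0// (le_trans _ p_ge1).
have p_neq0 : p != 0 by rewrite gt_eqF// (lt_le_trans _ p_ge1).
set F := (X in sup (range X)).
have unit x : rnorm (nrkernel H x) = 1 by exact: rnorm_nrkernel.
(* This uniform bound keeps [sup] from taking its default value. *)
have F_le x : F x <= (M ^+ 2) `^ (p / 2).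
  apply: mean_le => //; rewrite ?powR_ge0//.
    apply: ge0_ler_powR => //; rewrite ?nnegrE ?sqr_ge0//.
      exact: le_trans (sqr_ge0 _) (inner_unit_sqr_le T_bound (unit x)).
    exact: bound_le.
  rewrite (abs_op_sqr_unit M_ge1 T_bound).
  apply: ge0_ler_powR => //; rewrite ?nnegrE ?sqr_ge0//.
  rewrite ler_pXn2r ?nnegrE ?rnorm_ge0//.
  exact: (rnorm_unit_le T_bound).
(* The second arguments of the mean coincide; only the first one grows. *)
have le_F x : sigma_ mu (rnorm (inner H (T (nrkernel H x)) (nrkernel H x)) `^ p)
    (rnorm (T (nrkernel H x)) `^ p) <= F x.
  rewrite /F /= (abs_op_sqr_unit M_ge1 T_bound) powR_half ?rnorm_ge0//.
  apply: (mean_homol sm_mean); rewrite ?powR_ge0//.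
  rewrite -powR_half ?rnorm_ge0//.
  have le_bound := inner_unit_sqr_le T_bound (unit x).
  apply: ge0_ler_powR => //; rewrite nnegrE ?sqr_ge0//.
  exact: le_trans (sqr_ge0 _) le_bound.
have F_sup : has_sup (range F).
  split; first by have [x _] := Omega_neq0; exists (F x), x.
  by exists ((M ^+ 2) `^ (p / 2)) => _ [x _ <-].
have supF_ge x : F x <= sup (range F).
  by apply: sup_upper_bound => //; exists x.
have [x0 _] := Omega_neq0.
have supF_ge0 : 0 <= sup (range F).
  by rewrite (le_trans _ (supF_ge x0))// (mean_ge0 sm_mean)// powR_ge0.
rewrite /mean_ber_norm; set G := (X in sup (range X) `^ p).
have G_le x : G x <= sup (range F) `^ p^-1.
  apply: ge0_ler_powR.
  - by rewrite invr_ge0 (le_trans _ p_ge1).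
  - by rewrite nnegrE (mean_ge0 sm_mean)// powR_ge0.
  - by rewrite nnegrE.
  - exact: le_trans (le_F x) (supF_ge x).
have G_sup : has_sup (range G).
  split; first by exists (G x0), x0.
  by exists (sup (range F) `^ p^-1) => _ [x _ <-].
have supG_ge0 : 0 <= sup (range G).
  rewrite (@le_trans _ _ (G x0)) ?powR_ge0//.
  by apply: sup_upper_bound => //; exists x0.
(* The right side becomes [(sup F]^ p^-1) [^ p], so that monotonicity of the [p]-th power reduces
   the claim to [G_le]. *)
rewrite -[leRHS]powRr1// -(mulVf p_neq0) powRrM.
apply: ge0_ler_powR; rewrite ?nnegrE ?powR_ge0 ?(le_trans _ p_ge1)//.
by apply: ge_sup => [|_ [x _ <-]]; [case: G_sup|exact: G_le].
Qed.
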